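(* Let $\varphi,\psi:\mathbb{R}^{d_x}\to\mathbb{R}$ be convex, $F=\varphi+\psi$ (convex), and let $x_*$ be a minimizer of $F$. Let $\varepsilon>0$ and $\delta=(\delta_1,\delta_2)$. Suppose a $(\delta,L,\mu)$-oracle of $F$, a $(\delta,L_\varphi)$-oracle of $\varphi$ and a $(\delta,L_\psi)$-oracle of $\psi$ are available at every point. Run Algorithm R-AM (see context) with parameter $H\ge2L_\varphi$ from a starting point $z_0$ with $\|z_0-x_*\|\le R_0$ for some $R_0>0$, and assume that in each iteration of Algorithm AM used inside R-AM the auxiliary subproblem is solved inexactly so that $$\left(\langle\nabla\varphi_{\delta,L_\varphi}(x_k^{md}),x_{k+1}^t-x_k^{md}\rangle+\psi(x_{k+1}^t)+\frac H2\|x_{k+1}^t-x_k^{md}\|^2\right)-\min_{z\in\mathbb{R}^{d_x}}\left(\langle\nabla\varphi_{\delta,L_\varphi}(x_k^{md}),z-x_k^{md}\rangle+\psi(z)+\frac H2\|z-x_k^{md}\|^2\right)\le\tilde\varepsilon_f,$$ where $$\tilde\varepsilon_f\le\frac{\varepsilon\mu^2}{864^2(L+H)^2}.$$ Assume also that $$\delta_1,\delta_2\le\min\left\{\frac{\varepsilon\mu}{864^2L_\varphi},\frac{\varepsilon\mu}{864^2L_\psi},\frac{\varepsilon\mu^2}{864^2(L+H)^2},\frac{\varepsilon^{3/2}}{5\sqrt{8HR_0^2}}\right\}.$$ Then R-AM with $K=2\log_2\frac{\mu R_0^2}{4\varepsilon}$ (rounded up to an integer) outputs a point $z_K$ with $F(z_K)-F(x_*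 )\le\varepsilon$. Moreover, the total number $N_F$ of calls to the inexact oracles both for $\varphi$ and for $\psi$ satisfies $$N_F\le\left(16\sqrt2\sqrt{\frac H\mu}+2\right)\log_2\frac{\mu R_0^2}{\varepsilon}=\widetilde O\left(\max\left\{\sqrt{\frac H\mu},1\right\}\right).$$
   Context: $\|\cdot\|$ is the Euclidean norm. $\widetilde O(X)$ hides constant factors and factors polylogarithmic in $\varepsilon^{-1}$. Inexact oracles. Let $\delta=(\delta_1,\delta_2)$ with $\delta_1,\delta_2>0$. A pair $(\varphi_{\delta,L,\mu}(x),\nabla\varphi_{\delta,L,\mu}(x))\in\mathbb{R}\times\mathbb{R}^{d_x}$ is a $(\delta,L,\mu)$-oracle of a convex function $\varphi$ at $x$ if $\frac\mu2\|z-x\|^2-\delta_1\le\varphi(z)-(\varphi_{\delta,L,\mu}(x)+\langle\nabla\varphi_{\delta,L,\mu}(x),z-x\rangle)\le\frac L2\|z-x\|^2+\delta_2$ for all $z\in\mathbb{R}^{d_x}$. A $(\delta,L)$-oracle is the same with $\mu=0$. If a single number $\delta$ is given, then $(\delta_1,\delta_2)=(0,\delta)$. Algorithm AM. Input: $\varphi,\psi$ with their inexact oracles, $H>0$, starting point $x_0$. Set $A_0=0$, $x_0^t=x_0^{md}=x_0$. For $k=0,1,2,\dots$: (1) $a_{k+1}=\frac{1+\sqrt{1+8HA_k}}{4H}$, $A_{k+1}=A_k+a_{k+1}$; (2) $x_k^{md}=\frac{A_k}{A_{k+1}}x_k^t+\frac{a_{k+1}}{A_{k+1}}x_k$; (3)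 find $x_{k+1}^t$ as an approximate solution of the auxiliary subproblem $\min_{z}\{\varphi_{\delta,L_\varphi}(x_k^{md})+\langle\nabla\varphi_{\delta,L_\varphi}(x_k^{md}),z-x_k^{md}\rangle+\psi(z)+\frac H2\|z-x_k^{md}\|^2\}$; (4) $x_{k+1}=x_k-a_{k+1}\nabla\varphi_{\delta,L_\varphi}(x_{k+1}^t)-a_{k+1}\nabla\psi_{\delta,L_\psi}(x_{k+1}^t)$. Stopped after $N$ iterations, it outputs $x_N^t$. Algorithm R-AM (restarted AM). Input: as for AM, with starting point $z_0$ and $F=\varphi+\psi$ admitting a $(\delta,L,\mu)$-oracle. For $k=0,1,2,\dots$: set $N_k=\max\{\lceil(128H/\mu)^{1/2}\rceil,1\}$ and let $z_{k+1}=x_{N_k}^t$ be the output of AM started from $z_k$ and run for $N_k$ iterations. After $K$ restarts, output $z_K$.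
   Formalization: Assumes K ≥ 1, i.e. μR0² > 4ε (otherwise z_0 is output and the claim fails), and N_F counts one joint call per AM iteration: the bound holds for ψ-oracle calls, while φ-oracle calls number 2N_F, for which the stated bound fails in general. *)

(* Defs.v *)
From HB Require Import structures.
From mathcomp Require Import all_boot all_order all_algebra.
From mathcomp Require Import all_classical all_reals all_analysis.

Set Implicit Arguments.
Unset Strict Implicit.
Unset Printing Implicit Defensive.

Import Order.TTheory GRing.Theory Num.Theory.
Import numFieldNormedType.Exports.
Local Open Scope classical_set_scope.
Local Open Scope ring_scope.

Section Defs.
Variables (R : realType) (d : nat).
Local Notation V := 'rV[R]_d.
Implicit Types (phi psi f : V -> R) (x y z : V).

Definition dotv x y : R := \sum_(i < d) x 0 i * y 0 i.

(* The norm that the library puts on 'rV[R]_d is the max norm, hence this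
   Euclidean one. *)
Definition enorm x : R := Num.sqrt (dotv x x).

Definition is_minimizer f x := forall z, f x <= f z.

(* [o x] is the pair (value, gradient) that the oracle returns at [x]. *)
Definition oracle := V -> R * V.

Definition inexact_oracle (d1 d2 L mu : R) f (o : oracle) := forall x z,
  mu / 2 * enorm (z - x) ^+ 2 - d1
    <= f z - ((o x).1 + dotv (o x).2 (z - x))
    <= L / 2 * enorm (z - x) ^+ 2 + d2.

Definition am_inc (H A : R) : R := (1 + Num.sqrt (1 + 8 * H * A)) / (4 * H).

Fixpoint am_A (H : R) (k : nat) : R :=
  if k is k'.+1 then am_A H k' + am_inc H (am_A H k') else 0.

(* [am_a H k] is a_{k+1}. *)
Definition am_a (H : R) (k : nat) : R := am_inc H (am_A H k).

(* The objective of the auxiliary subproblem at [y] = x_k^md, without the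
   additive constant (o y).1. *)
Definition am_sub psi (o : oracle) (H : R) y z : R :=
  dotv (o y).2 (z - y) + psi z + H / 2 * enorm (z - y) ^+ 2.

Definition approx_min f (tol : R) x :=
  exists2 zmin, is_minimizer f zmin & f x - f zmin <= tol.

(* The iterates x_k, x_k^t and x_k^md of one execution of AM. *)
Record am_trace := AmTrace {
  am_x : nat -> V;
  am_xt : nat -> V;
  am_xmd : nat -> V
}.

(* [T] is an execution of the first [N] iterations of AM from [x0].  This is a
   relation and not a function, because step (3) leaves the choice of
   x_{k+1}^t among the points of accuracy [tol] open.  As A_0 = 0, the
   initialization x_0^md = x_0 is the case k = 0 of step (2). *)
Definition am_run psi (ophi opsi : oracle) (H tol : R) x0 (N : nat)
    (T : am_trace) :=
  [/\ am_x T 0%N = x0, am_xt T 0%N = x0 &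
    forall k, (k < N)%N ->
    [/\ am_xmd T k = (am_A H k / am_A H k.+1) *: am_xt T k
                     + (am_a H k / am_A H k.+1) *: am_x T k,
        approx_min (am_sub psi ophi H (am_xmd T k)) tol (am_xt T k.+1)
      & am_x T k.+1 = am_x T k - am_a H k *: (ophi (am_xt T k.+1)).2
                               - am_a H k *: (opsi (am_xt T k.+1)).2]].

Definition restart_len (H mu : R) : nat :=
  maxn `|Num.ceil (Num.sqrt (128 * H / mu))|%N 1.

(* [T k] is the execution of AM in the restart number [k], and [z k] the point
   from which it starts. *)
Definition ram_run psi (ophi opsi : oracle) (H mu tol : R) z0 (K : nat)
    (T : nat -> am_trace) (z : nat -> V) :=
  z 0%N = z0 /\
  forall k, (k < K)%N ->
    am_run psi ophi opsi H tol (z k) (restart_len H mu) (T k) /\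
    z k.+1 = am_xt (T k) (restart_len H mu).

(* The points at which the oracles are queried: in each iteration of AM, that
   of phi at x_k^md in step (3) and at x_{k+1}^t in step (4), that of psi at
   x_{k+1}^t in step (4). *)
Definition ram_phi_queries (H mu : R) (K : nat) (T : nat -> am_trace) : seq V :=
  flatten [seq flatten [seq [:: am_xmd (T k) j; am_xt (T k) j.+1]
                       | j <- iota 0 (restart_len H mu)]
          | k <- iota 0 K].

Definition ram_psi_queries (H mu : R) (K : nat) (T : nat -> am_trace) : seq V :=
  flatten [seq [seq am_xt (T k) j.+1 | j <- iota 0 (restart_len H mu)]
          | k <- iota 0 K].

End Defs.

Definition log2 (R : realType) (x : R) : R := ln x / ln 2.

(* N_F: the queries of one iteration of AM are counted as one call to the pair
   of oracles of phi and psi. *)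
Definition ram_calls (R : realType) (H mu : R) (K : nat) : nat :=
  (\sum_(k < K) restart_len H mu)%N.

Definition calls_bound (R : realType) (H mu R0 eps : R) : R :=
  (16 * Num.sqrt 2 * Num.sqrt (H / mu) + 2) * log2 (mu * R0 ^+ 2 / eps).

(* f = O~(g) as eps -> 0+, for a family f indexed by the parameters [t] in [D]:
   the constant and the degree of the polylogarithmic factor are uniform in the
   parameters; only the range of eps may depend on them. *)
Definition softO (R : realType) (P : Type) (D : set P) (f : P -> R -> R)
    (g : P -> R) :=
  exists (C : R) (p : nat), forall t, D t ->
    \forall eps \near 0^'+, `|f t eps| <= C * (ln eps^-1) ^+ p * `|g t|.

(* Main.v *)
(* One step of AM decreases the Lyapunov function
   A_k (F(x_k^t) - min F) + |x_k - xstar|^2 / 2 up to A_{k+1} times an error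
   proportional to the inexactness, because a_{k+1}^2 = A_{k+1} / (2H) and the
   gradient of phi varies by at most (H/2)|x_{k+1}^t - x_k^md| between the two
   query points.  As A_N >= N^2 / (8H), a run of N >= sqrt(128 H / mu) steps
   from z ends with a gap of at most mu |z - xstar|^2 / 32 + eps / 70, and
   strong convexity turns this into a contraction of |z - xstar|^2.  When
   128 H <= mu the Lyapunov errors, of order eps mu / H, are too large; then
   N = 1, and the accuracy of the single subproblem bounds the gap directly. *)
Require Import Defs.
From HB Require Import structures.
From mathcomp Require Import all_boot all_order all_algebra.
From mathcomp Require Import all_classical all_reals all_analysis.
From mathcomp Require Import ring lra.

Set Implicit Arguments.
Unset Strict Implicit.
Unset Printing Implicit Defensive.

Import Order.TTheory GRing.Theory Num.Theory.
Import numFieldNormedType.Exports.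
Local Open Scope classical_set_scope.
Local Open Scope ring_scope.

(** * Euclidean inner product on row vectors *)

Section InnerProduct.
Variables (R : realType) (d : nat).
Implicit Types (u v x y z h : 'rV[R]_d).

Lemma dotvC x y : dotv x y = dotv y x.
Proof. by apply: eq_bigr => i _; rewrite mulrC. Qed.

Lemma dotvDr x y z : dotv x (y + z) = dotv x y + dotv x z.
Proof. by rewrite -big_split; apply: eq_bigr => i _; rewrite mxE mulrDr. Qed.

Lemma dotvZr a x y : dotv x (a *: y) = a * dotv x y.
Proof. by rewrite big_distrr; apply: eq_bigr => i _; rewrite mxE mulrCA. Qed.

Lemma dotvNr x y : dotv x (- y) = - dotv x y.
Proof. by rewrite -scaleN1r dotvZr mulN1r. Qed.

Lemma dotvDl x y z : dotv (x + y) z = dotv x z + dotv y z.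
Proof. by rewrite dotvC dotvDr !(dotvC z). Qed.

Lemma dotvZl a x y : dotv (a *: x) y = a * dotv x y.
Proof. by rewrite dotvC dotvZr dotvC. Qed.

Lemma dotvNl x y : dotv (- x) y = - dotv x y.
Proof. by rewrite dotvC dotvNr dotvC. Qed.

Lemma dotv0 x : dotv x 0 = 0.
Proof. by rewrite -(scale0r 0) dotvZr mul0r. Qed.

Definition dotvE := (dotvDl, dotvDr, dotvNl, dotvNr, dotvZl, dotvZr).

Lemma dotv_ge0 x : 0 <= dotv x x.
Proof. by apply: sumr_ge0 => i _; rewrite -expr2 sqr_ge0. Qed.

Lemma sqr_enorm x : enorm x ^+ 2 = dotv x x.
Proof. by rewrite sqr_sqrtr // dotv_ge0. Qed.

Lemma dotv_delta (i : 'I_d) : dotv (delta_mx 0 i) (delta_mx 0 i) = 1 :> R.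
Proof.
rewrite /dotv (bigD1 i) //= !mxE !eqxx mulr1 big1 ?addr0 // => j ji.
by rewrite !mxE (negPf ji) andbF mul0r.
Qed.

Lemma dotv_young x y a : 2 * a * dotv x y <= dotv x x + a ^+ 2 * dotv y y.
Proof. by have := dotv_ge0 (x - a *: y); rewrite !dotvE (dotvC y x); lra. Qed.

(** The hypothesis is tested at [h = M^-1 *: u], which maximizes [dotv u h - M / 2 * dotv h h]; the
    maximum is [dotv u u / (2 * M)]. *)
Lemma sqr_norm_le_of_quadratic (u : 'rV[R]_d) (M c : R) : 0 < M ->
  (forall h, dotv u h <= M / 2 * dotv h h + c) -> dotv u u <= 2 * M * c.
Proof.
move=> M0 /(_ (M^-1 *: u)); rewrite !dotvE => le_u.
have -> : dotv u u
    = 2 * M * (M^-1 * dotv u u - M / 2 * (M^-1 * (M^-1 * dotv u u))).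
  by field; rewrite gt_eqF.
by rewrite ler_pM2l ?mulr_gt0 //; lra.
Qed.

End InnerProduct.

(** * Consequences of having an inexact oracle *)

Section InexactOracle.
Variables (R : realType) (d : nat) (f : 'rV[R]_d -> R) (o : oracle R d).
Variables (d1 d2 L mu : R).
Hypothesis of_ : inexact_oracle d1 d2 L mu f o.
Implicit Types (x y z h : 'rV[R]_d).

Lemma inexact_oracle_ge x h :
  (o x).1 + dotv (o x).2 h + mu / 2 * dotv h h - d1 <= f (x + h).
Proof.
have /andP[+ _] := of_ x (x + h).
by rewrite [x + h]addrC addrK sqr_enorm; lra.
Qed.

Lemma inexact_oracle_le x h :
  f (x + h) <= (o x).1 + dotv (o x).2 h + L / 2 * dotv h h + d2.
Proof.
have /andP[_ +] := of_ x (x + h).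
by rewrite [x + h]addrC addrK sqr_enorm; lra.
Qed.

Lemma inexact_oracle_val_le x : (o x).1 - d1 <= f x.
Proof. by have := inexact_oracle_ge x 0; rewrite !dotv0 !addr0; lra. Qed.

Lemma inexact_oracle_val_ge x : f x <= (o x).1 + d2.
Proof. by have := inexact_oracle_le x 0; rewrite !dotv0 !addr0; lra. Qed.

(** The two bounds at one query point force [(mu - L) / 2 * r ^+ 2 <= d1 + d2] at every distance
    [r], which fails for large [r] if [L < mu]. A nonzero direction exists only when [0 < d]. *)
Lemma inexact_oracle_strong_le : (0 < d)%N -> mu <= L.
Proof.
case: d f o of_ => // n g og ogP _; rewrite leNgt; apply/negP => Lmu.
have D0 : 0 <= d1 + d2.
  by have /andP[] := ogP 0 0; rewrite subrr sqr_enorm !dotv0; lra.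
(* This [r] makes [(mu - L) / 2 * r ^+ 2] equal to [d1 + d2 + 1]. *)
pose r := Num.sqrt (2 * (d1 + d2 + 1) / (mu - L)).
have /andP[] := ogP 0 (r *: delta_mx 0 ord0).
rewrite subr0 sqr_enorm !dotvE dotv_delta mulr1.
rewrite -expr2 sqr_sqrtr; last by rewrite divr_ge0 //; lra.
set q := _ / (mu - L) => le1 le2.
have : q * (mu - L) = 2 * (d1 + d2 + 1) by rewrite divfK //; lra.
by lra.
Qed.

(* The oracle at the midpoint is used because its gradient at the minimizer
   itself need not vanish. *)
Lemma inexact_oracle_growth x0 x : is_minimizer f x0 ->
  mu / 4 * dotv (x - x0) (x - x0) <= f x - f x0 + 2 * (d1 + d2).
Proof.
move=> x0_min; pose h := 2^-1 *: (x - x0); pose m := x0 + h.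
have mh : m + h = x.
  rewrite /m /h -addrA -scalerDl; have -> : 2^-1 + 2^-1 = 1 :> R by field.
  by rewrite scale1r addrC subrK.
have mNh : m + - h = x0 by rewrite /m addrK.
(* Adding the lower bounds at [m + h] and [m - h] cancels the gradient; [|h|^2 = |x - x0|^2 / 4]
   gives [mu / 4]. *)
have := inexact_oracle_ge m h; have := inexact_oracle_ge m (- h).
have := inexact_oracle_val_ge m; have := x0_min m.
by rewrite mh mNh !dotvNl !dotvNr {2 3 5 6}/h !dotvZl !dotvZr; lra.
Qed.

End InexactOracle.

(** At a common point, the lower bound from one query is compared with the upper bound from the
    other, and the displacement is optimized ([half]). Adding the two orders cancels the oracle
    values. *)
Lemma inexact_oracle_cocoercive (R : realType) (d : nat) (f : 'rV[R]_d -> R)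
    (o : oracle R d) (d1 d2 L : R) (x y : 'rV[R]_d) :
  0 < L -> inexact_oracle d1 d2 L 0 f o ->
  dotv ((o x).2 - (o y).2) ((o x).2 - (o y).2)
    <= L * dotv ((o x).2 - (o y).2) (x - y) + 2 * L * (d1 + d2).
Proof.
move=> L0 oP.
have half a b : dotv ((o a).2 - (o b).2) ((o a).2 - (o b).2) <=
    2 * L * ((o b).1 - (o a).1 - dotv (o a).2 (b - a) + (d1 + d2)).
  apply: sqr_norm_le_of_quadratic => // h.
  have := inexact_oracle_le oP b h.
  have := inexact_oracle_ge oP a (b - a + h).
  by rewrite addrA addrCA subrr addr0 !dotvE; lra.
have := half x y; have := half y x.
rewrite -opprB !dotvE !(dotvC (o y).2 (o x).2); lra.
Qed.

(** * Growth of the step sizes *)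

Section StepSizes.
Variables (R : realType) (H : R).
Hypothesis H_gt0 : 0 < H.

(** By induction the square root is at least [k], so the increment is at least [(1 + k) / (4 * H)],
    and [k^2 + 2 (k + 1) >= (k + 1)^2]. *)
Lemma am_A_ge k : k%:R ^+ 2 / (8 * H) <= am_A H k.
Proof.
elim: k => [|k IH] /=; first by rewrite expr0n mul0r.
have k_le : k%:R <= Num.sqrt (1 + 8 * H * am_A H k).
  rewrite -(ger0_norm (ler0n R k)) -sqrtr_sqr ler_wsqrtr //.
  have : k%:R ^+ 2 <= 8 * H * am_A H k.
    by rewrite mulrC -ler_pdivrMr ?mulr_gt0.
  by lra.
have inc_ge : (1 + k%:R) / (4 * H) <= am_inc H (am_A H k).
  by rewrite /am_inc ler_pM2r ?invr_gt0 ?mulr_gt0 // lerD2l.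
apply: le_trans (lerD IH inc_ge).
have -> : k%:R ^+ 2 / (8 * H) + (1 + k%:R) / (4 * H)
    = (k%:R ^+ 2 + 2 * (1 + k%:R)) / (8 * H) :> R by field; rewrite gt_eqF.
rewrite ler_pM2r ?invr_gt0 ?mulr_gt0 // -natr1; lra.
Qed.

Lemma am_A_ge0 k : 0 <= am_A H k.
Proof.
by apply: le_trans (am_A_ge k); rewrite divr_ge0 ?sqr_ge0 // mulr_ge0 // ltW.
Qed.

Lemma am_a_gt0 k : 0 < am_a H k.
Proof.
by rewrite /am_a /am_inc divr_gt0 ?mulr_gt0 // ltr_pwDl ?sqrtr_ge0.
Qed.

Lemma am_A_gt0 k : 0 < am_A H k.+1.
Proof. by rewrite /= ltr_wpDl ?am_A_ge0 ?am_a_gt0. Qed.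

(** [am_a H k] is the positive root of [2 * H * a ^+ 2 - a = am_A H k]. *)
Lemma am_A_quad k : am_A H k.+1 = 2 * H * am_a H k ^+ 2.
Proof.
rewrite /= -/(am_a H k) /am_a /am_inc.
set s := Num.sqrt _.
have s2 : s ^+ 2 = 1 + 8 * H * am_A H k.
  by rewrite sqr_sqrtr // addr_ge0 // !mulr_ge0 ?am_A_ge0 // ltW.
have -> : am_A H k = (s ^+ 2 - 1) / (8 * H).
  by rewrite s2; field; rewrite gt_eqF.
by field; rewrite gt_eqF.
Qed.

End StepSizes.

(** * Lyapunov decrease in one AM step *)

Section AcceleratedMethod.
Variables (R : realType) (d : nat) (phi psi : 'rV[R]_d -> R).
Variables (d1 d2 L mu Lphi Lpsi H tol : R) (oF ophi opsi : oracle R d).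
Let F x := phi x + psi x.
Hypothesis oF_inexact : inexact_oracle d1 d2 L mu F oF.
Hypothesis ophi_inexact : inexact_oracle d1 d2 Lphi 0 phi ophi.
Hypothesis opsi_inexact : inexact_oracle d1 d2 Lpsi 0 psi opsi.
Hypothesis Lphi_gt0 : 0 < Lphi.
Hypotheses (H_gt0 : 0 < H) (H_ge : 2 * Lphi <= H).

Definition am_grad t := (ophi t).2 + (opsi t).2.

(* An approximate gradient at [t] of the objective [am_sub] of the auxiliary
   subproblem, hence small. *)
Definition am_residual y t := (ophi y).2 + (opsi t).2 + H *: (t - y).

(* Since [psi = F - phi] is a difference of functions with oracles, it obeys a
   quadratic upper bound with constant [L], whatever [Lpsi] is. *)
Lemma am_residual_le y t : 0 < L -> approx_min (am_sub psi ophi H y) tol t ->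
  dotv (am_residual y t) (am_residual y t)
    <= 2 * (2 * L + H) * (tol + 5 * (d1 + d2)).
Proof.
move=> L0 [zmin zmin_min tol_ge].
apply: sqr_norm_le_of_quadratic => [|h].
  by apply: addr_gt0; rewrite ?mulr_gt0.
(* The bounds at [t + h] replace the gradient of [oF] by the sum of the other two; those at [t - h]
   bound [psi] from above. Each use of [oF] costs [L / 2], hence [2 * L + H]. *)
have := zmin_min (t + - h).
have := inexact_oracle_le oF_inexact t h.
have := inexact_oracle_le oF_inexact t (- h).
have := inexact_oracle_ge ophi_inexact t h.
have := inexact_oracle_ge ophi_inexact t (- h).
have := inexact_oracle_ge opsi_inexact t h.
have := inexact_oracle_val_le oF_inexact t.
have := inexact_oracle_val_ge ophi_inexact t.
have := inexact_oracle_val_ge opsi_inexact t.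
have := tol_ge; rewrite /am_sub !sqr_enorm.
rewrite /am_residual /F !dotvE !(dotvC h y, dotvC h t, dotvC y t).
lra.
Qed.

(** If the residual and the variation [D] of the gradient of [phi] vanished, then [G = - H *: s] and
    the left side would be [- 3 / 4 * H * |s|^2]. This negative term absorbs [D]. *)
Lemma am_progress y t :
  dotv (am_grad t) (am_grad t) / (4 * H) + dotv (am_grad t) (t - y)
    <= 3 / 4 * dotv (am_residual y t) (am_residual y t) / H + 2 * (d1 + d2).
Proof.
set G := am_grad t; set v := am_residual y t.
pose s := t - y; pose D := (ophi t).2 - (ophi y).2.
have GE : G = v + D - H *: s.
  rewrite /G /v /am_grad /am_residual /D /s.
  by apply/rowP => i; rewrite !mxE; ring.
have := inexact_oracle_cocoercive t y Lphi_gt0 ophi_inexact.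
rewrite -/D -/s => DD; clearbody G v D s.
have e_ge0 : 0 <= d1 + d2.
  have := inexact_oracle_val_le ophi_inexact y.
  by have := inexact_oracle_val_ge ophi_inexact y; lra.
have HLe : 0 <= (H - 2 * Lphi) * (d1 + d2) by rewrite mulr_ge0 // subr_ge0.
have HLs : 4 * Lphi ^+ 2 * dotv s s <= H ^+ 2 * dotv s s.
  rewrite ler_wpM2r ?dotv_ge0 //.
  have -> : 4 * Lphi ^+ 2 = (2 * Lphi) ^+ 2 by ring.
  by rewrite lerXn2r ?nnegrE // ltW ?mulr_gt0.
(* Cocoercivity and Young's inequality with weight [Lphi] give
   [Lphi^2 |s|^2 + 4 * Lphi * (d1 + d2)]; then [2 * Lphi <= H]. *)
have D_le : dotv D D <= 2 * H * (d1 + d2) + H ^+ 2 / 4 * dotv s s.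
  by have := dotv_young D s Lphi; lra.
(* With these weights the positive multiples of [H^2 |s|^2] add up to [5 / 2], below the available
   [3]. *)
have vD := dotv_young v D 1.
have Ds := dotv_young D s (H / 2).
have vs := dotv_young v s H.
have ss : 0 <= H ^+ 2 * dotv s s by rewrite mulr_ge0 ?sqr_ge0 ?dotv_ge0.
rewrite -(ler_pM2l (mulr_gt0 (ltr0n R 4) H_gt0)).
have -> : 4 * H * (dotv G G / (4 * H) + dotv G s) = dotv G G + 4 * H * dotv G s.
  by field; rewrite gt_eqF.
have -> : 4 * H * (3 / 4 * dotv v v / H + 2 * (d1 + d2))
    = 3 * dotv v v + 8 * H * (d1 + d2) by field; rewrite gt_eqF.
rewrite GE !dotvE (dotvC D v) (dotvC s v) (dotvC s D).
lra.
Qed.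

(* Half of the term [4 * (d1 + d2)] comes from the subgradient inequality for
   [F], the other half from [am_progress]. *)
Lemma am_step A A' a x xt y t x' xstar :
  0 <= A -> 0 < a -> A' = A + a -> A' = 2 * H * a ^+ 2 ->
  y = (A / A') *: xt + (a / A') *: x ->
  x' = x - a *: (ophi t).2 - a *: (opsi t).2 ->
  A' * (F t - F xstar) + dotv (x' - xstar) (x' - xstar) / 2 <=
  A * (F xt - F xstar) + dotv (x - xstar) (x - xstar) / 2
    + A' * (3 / 4 * dotv (am_residual y t) (am_residual y t) / H
            + 4 * (d1 + d2)).
Proof.
move=> A_ge0 a_gt0 A'E A'H yE x'E0.
set v := am_residual y t; set G := am_grad t.
have A'_gt0 : 0 < A' by lra.
have subgrad z : F t + dotv G (z - t) - 2 * (d1 + d2) <= F z.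
  have := inexact_oracle_ge ophi_inexact t (z - t).
  have := inexact_oracle_ge opsi_inexact t (z - t).
  have := inexact_oracle_val_ge ophi_inexact t.
  have := inexact_oracle_val_ge opsi_inexact t.
  by rewrite /F /G /am_grad [t + _]addrC subrK dotvDl; lra.
(* The coupling in step (2) makes the inner products with [G] collect into [A' * dotv G (t - y)], as
   in [am_progress]. *)
have axE : a *: x = A' *: y - A *: xt.
  rewrite yE scalerDr !scalerA ![A' * _]mulrC !divfK ?gt_eqF //.
  by rewrite addrC addKr.
have x'E : x' = x - a *: G by rewrite x'E0 /G scalerDr opprD addrA.
have := ler_wpM2l (ltW A'_gt0) (am_progress y t).
rewrite -/G -/v => prog; clearbody G v.
(* The gradient step adds [a ^+ 2 / 2 * dotv G G], which [A' = 2 * H * a ^+ 2] turns into the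
   quadratic term of [am_progress]. *)
have norm_x' : dotv (x' - xstar) (x' - xstar) / 2 =
    dotv (x - xstar) (x - xstar) / 2 - dotv G (a *: x) + a * dotv G xstar
    + A' * (dotv G G / (4 * H)).
  have -> : A' * (dotv G G / (4 * H)) = a ^+ 2 / 2 * dotv G G.
    by rewrite A'H; field; rewrite gt_eqF.
  by rewrite x'E !dotvE !(dotvC x G, dotvC xstar G) (dotvC xstar x); lra.
have := ler_wpM2l A_ge0 (subgrad xt).
have := ler_wpM2l (ltW a_gt0) (subgrad xstar).
by move: prog; rewrite norm_x' axE !dotvE A'E; lra.
Qed.
End AcceleratedMethod.

(** * Convergence of a whole AM run *)

Section AcceleratedMethodRun.
Variables (R : realType) (d : nat) (phi psi : 'rV[R]_d -> R).
Variables (d1 d2 L mu Lphi Lpsi H tol : R) (oF ophi opsi : oracle R d).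
Let F x := phi x + psi x.
Hypothesis oF_inexact : inexact_oracle d1 d2 L mu F oF.
Hypothesis ophi_inexact : inexact_oracle d1 d2 Lphi 0 phi ophi.
Hypothesis opsi_inexact : inexact_oracle d1 d2 Lpsi 0 psi opsi.
Hypotheses (L_gt0 : 0 < L) (Lphi_gt0 : 0 < Lphi).
Hypotheses (H_gt0 : 0 < H) (H_ge : 2 * Lphi <= H).
Variables (x0 xstar : 'rV[R]_d) (N : nat) (T : am_trace R d).
Hypothesis run : am_run psi ophi opsi H tol x0 N T.

(** The error of [am_step] with the bound of [am_residual_le] inserted. *)
Definition am_step_error := 3 / 2 * (2 * L + H) * (tol + 5 * (d1 + d2)) / H
  + 4 * (d1 + d2).

Lemma am_run_lyapunov k : (k <= N)%N ->
  am_A H k * (F (am_xt T k) - F xstar)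
    + dotv (am_x T k - xstar) (am_x T k - xstar) / 2
  <= dotv (x0 - xstar) (x0 - xstar) / 2 + k%:R * am_A H k * am_step_error.
Proof.
have [x0E _ runS] := run.
elim: k => [_|k IH kN]; first by rewrite x0E !mul0r add0r addr0.
have [yE tP x'E] := runS k kN.
have A_ge0 := am_A_ge0 H_gt0 k; have a_gt0 := am_a_gt0 H_gt0 k.
have A'_gt0 := am_A_gt0 H_gt0 k.
have step := am_step (A' := am_A H k.+1) ophi_inexact opsi_inexact Lphi_gt0
  H_gt0 H_ge xstar A_ge0 a_gt0 erefl (am_A_quad H_gt0 k) yE x'E.
have v_le := am_residual_le oF_inexact ophi_inexact opsi_inexact H_gt0 L_gt0 tP.
have v_ge0 := dotv_ge0 (am_residual H ophi opsi (am_xmd T k) (am_xt T k.+1)).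
set v2 := dotv (am_residual _ _ _ _ _) _ in step v_le v_ge0.
have D_ge0 : 0 <= d1 + d2.
  have := inexact_oracle_val_le ophi_inexact x0.
  by have := inexact_oracle_val_ge ophi_inexact x0; lra.
have step_le : 3 / 4 * v2 / H + 4 * (d1 + d2) <= am_step_error.
  rewrite /am_step_error lerD2r ler_pM2r ?invr_gt0 //; lra.
have err_ge0 : 0 <= am_step_error.
  by apply: le_trans step_le; rewrite addr_ge0 ?divr_ge0 ?mulr_ge0 // ltW.
apply: le_trans step _.
(* Monotonicity of [am_A H] bounds the accumulated weights of the errors by [k * A_k]. *)
have A_le : am_A H k <= am_A H k.+1 by rewrite /= lerDl ltW.
have := IH (ltnW kN); have := ler_wpM2l (ltW A'_gt0) step_le.
have := ler_wpM2l (mulr_ge0 (ler0n R k) err_ge0) A_le.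
rewrite -natr1 /F; lra.
Qed.

Lemma am_run_rate : (0 < N)%N -> F (am_xt T N) - F xstar <=
  4 * H / N%:R ^+ 2 * dotv (x0 - xstar) (x0 - xstar) + N%:R * am_step_error.
Proof.
move=> N0; have := am_run_lyapunov (leqnn N).
have A_gt0 : 0 < am_A H N by case: N N0 => // n _; exact: am_A_gt0.
have A_ge := am_A_ge H_gt0 N.
have N_gt0 : 0 < N%:R :> R by rewrite ltr0n.
move=> lyap; have r_ge0 := dotv_ge0 (x0 - xstar).
have r'_ge0 := dotv_ge0 (am_x T N - xstar).
rewrite -(ler_pM2l A_gt0).
have : dotv (x0 - xstar) (x0 - xstar) / 2
    <= am_A H N * (4 * H / N%:R ^+ 2 * dotv (x0 - xstar) (x0 - xstar)).
  have -> : dotv (x0 - xstar) (x0 - xstar) / 2 = N%:R ^+ 2 / (8 * H)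
      * (4 * H / N%:R ^+ 2 * dotv (x0 - xstar) (x0 - xstar)).
    by field; rewrite !gt_eqF.
  by rewrite ler_wpM2r // !mulr_ge0 ?invr_ge0 ?sqr_ge0 // ltW.
lra.
Qed.

(** As A_0 = 0, the first subproblem is centred at [x0]. Comparing its values at x_1^t and [xstar]
    avoids [am_step_error]; the term [H / 2 * |t - x0|^2] covers the smoothness of [phi]. *)
Lemma am_run_first : (0 < N)%N -> F (am_xt T 1) - F xstar <=
  H / 2 * dotv (x0 - xstar) (x0 - xstar) + tol + (d1 + d2).
Proof.
move=> N0; have [x0E _ /(_ 0%N N0)[yE [zmin zmin_min le_tol] _]] := run.
have {}yE : am_xmd T 0 = x0.
  rewrite yE x0E mul0r scale0r add0r /= add0r divff ?scale1r //.
  by rewrite gt_eqF // am_a_gt0.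
move: zmin_min le_tol; rewrite yE => /(_ xstar).
set t := am_xt T 1.
have := inexact_oracle_ge ophi_inexact x0 (xstar - x0).
have := inexact_oracle_le ophi_inexact x0 (t - x0).
have : 2 * Lphi * dotv (t - x0) (t - x0) <= H * dotv (t - x0) (t - x0).
  by rewrite ler_wpM2r // dotv_ge0.
have : 0 <= H * dotv (t - x0) (t - x0) by rewrite mulr_ge0 ?dotv_ge0 // ltW.
rewrite /am_sub !sqr_enorm !(addrC x0 (_ - x0)) !subrK -[xstar - x0]opprB.
rewrite !dotvNr !dotvNl /F; lra.
Qed.

End AcceleratedMethodRun.

(** * Bounds on the restart length *)

Section RestartLength.
Variables (R : realType) (H mu : R).
Hypotheses (H_gt0 : 0 < H) (mu_gt0 : 0 < mu).

Lemma restart_len_gt0 : (0 < restart_len H mu)%N.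
Proof. by rewrite leq_max orbT. Qed.

Lemma natr_restart_len :
  (restart_len H mu)%:R
    = Num.max (Num.ceil (Num.sqrt (128 * H / mu)))%:~R 1 :> R.
Proof.
rewrite /restart_len; set c := Num.ceil _.
have c_ge0 : 0 <= c by rewrite ceil_ge0 (lt_le_trans _ (sqrtr_ge0 _)) ?ltrN10.
by rewrite -[c in RHS]gez0_abs // -pmulrn -[1 in RHS]/(1%:R) -natr_max.
Qed.

Lemma restart_len_ge : Num.sqrt (128 * H / mu) <= (restart_len H mu)%:R.
Proof. by rewrite natr_restart_len le_max ceil_ge. Qed.

Lemma restart_len_le : (restart_len H mu)%:R <= Num.sqrt (128 * H / mu) + 1.
Proof.
rewrite natr_restart_len ge_max lerDr sqrtr_ge0 andbT.
have := ceilB1_lt (Num.sqrt (128 * H / mu)); rewrite intrD; lra.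
Qed.

Lemma restart_len_eq1 : 128 * H <= mu -> restart_len H mu = 1%N.
Proof.
move=> H_le; apply/eqP; rewrite -(eqr_nat R) natr_restart_len max_r //.
rewrite -[leRHS]/(1%:~R) ler_int ceil_le_int -[leRHS]sqrtr1 ler_wsqrtr //.
by rewrite ler_pdivrMr // mul1r.
Qed.

End RestartLength.

(** * Contraction over the restarts *)

Section Restart.
Variables (R : realType) (d : nat) (phi psi : 'rV[R]_d -> R).
Variables (eps acc d1 d2 L mu Lphi Lpsi H tol : R) (oF ophi opsi : oracle R d).
Let F x := phi x + psi x.
Hypothesis oF_inexact : inexact_oracle d1 d2 L mu F oF.
Hypothesis ophi_inexact : inexact_oracle d1 d2 Lphi 0 phi ophi.
Hypothesis opsi_inexact : inexact_oracle d1 d2 Lpsi 0 psi opsi.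
Hypotheses (acc_gt0 : 0 < acc) (acc_le : 10500 * acc <= eps).
Hypotheses (mu_gt0 : 0 < mu) (mu_le : mu <= L).
Hypotheses (Lphi_gt0 : 0 < Lphi) (H_gt0 : 0 < H) (H_ge : 2 * Lphi <= H).
Let q := acc * mu ^+ 2 / (L + H) ^+ 2.
Hypotheses (tol_le : tol <= q) (d1_le : d1 <= q) (d2_le : d2 <= q).
Variable xstar : 'rV[R]_d.

Let LH_gt0 : 0 < L + H.
Proof. by rewrite addr_gt0 // (lt_le_trans mu_gt0). Qed.

Let eps_gt0 : 0 < eps.
Proof. have := acc_le; have := acc_gt0; lra. Qed.

Let q_ge0 : 0 <= q.
Proof. by rewrite divr_ge0 ?mulr_ge0 ?exprn_ge0 // ltW. Qed.

Lemma accuracy_le : q <= acc.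
Proof.
rewrite ler_pdivrMr ?exprn_gt0 // ler_pM2l //.
rewrite lerXn2r ?nnegrE ?(ltW LH_gt0) ?(ltW mu_gt0) //.
by rewrite (le_trans mu_le) // lerDl ltW.
Qed.

(** One factor [mu / (L + H)] of [q] cancels the condition number of the subproblem error; the other
    is at most [1]. *)
Lemma accuracy_condition_le : (L + H) / H * q <= acc * (mu / H).
Proof.
have -> : (L + H) / H * q = acc * (mu / H) * (mu / (L + H)).
  by rewrite /q; field; rewrite !gt_eqF.
rewrite ger_pMr ?mulr_gt0 ?divr_gt0 ?invr_gt0 // ler_pdivrMr // mul1r.
by rewrite (le_trans mu_le) // lerDl ltW.
Qed.

(** [41 = 33 + 8]: [tol + 5 * (d1 + d2) <= 11 * q] enters with factor [3], and
    [4 * (d1 + d2) <= 8 * q]. *)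
Lemma am_step_error_le :
  am_step_error d1 d2 L H tol <= 41 * (acc * (mu / H)).
Proof.
have LH_ge1 : 1 <= (L + H) / H.
  by rewrite ler_pdivlMr // mul1r lerDr (le_trans _ mu_le) // ltW.
have le1 : 3 / 2 * (2 * L + H) * (tol + 5 * (d1 + d2)) / H
    <= 33 * ((L + H) / H * q).
  have -> : 33 * ((L + H) / H * q) = 3 / 2 * (2 * L + 2 * H) * (11 * q) / H.
    by field; rewrite gt_eqF.
  rewrite ler_pM2r ?invr_gt0 //.
  apply: (@le_trans _ _ (3 / 2 * (2 * L + H) * (11 * q))).
    have L_gt0 := lt_le_trans mu_gt0 mu_le.
    rewrite ler_wpM2l //; first by have := H_gt0; lra.
    have := tol_le; have := d1_le; have := d2_le; lra.
  by have := mulr_ge0 (ltW H_gt0) q_ge0; lra.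
have := ler_wpM2r q_ge0 LH_ge1.
have := accuracy_condition_le; have := d1_le; have := d2_le.
rewrite /am_step_error; lra.
Qed.

(* The constant in [acc_le] comes from the [41] of [am_step_error_le], the [128]
   of [restart_len] and the bound [restart_len H mu <= 2 * sqrt (128 * H / mu)]:
   [10496 = 2 * 128 * 41]. *)
Lemma am_restart_gap x0 T :
  am_run psi ophi opsi H tol x0 (restart_len H mu) T ->
  F (am_xt T (restart_len H mu)) - F xstar
    <= mu / 32 * dotv (x0 - xstar) (x0 - xstar) + eps.
Proof.
move=> run; have r_ge0 := dotv_ge0 (x0 - xstar).
have N_gt0 := restart_len_gt0 H mu.
have [muH|muH] := leP (128 * H) mu.
  have := am_run_first ophi_inexact H_gt0 H_ge xstar run N_gt0.
  rewrite restart_len_eq1 // => gap_le.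
  have Hr : 128 * H * dotv (x0 - xstar) (x0 - xstar)
      <= mu * dotv (x0 - xstar) (x0 - xstar) by rewrite ler_wpM2r.
  have := accuracy_le; have := tol_le; have := d1_le; have := d2_le.
  have := acc_le; have := acc_gt0; have := mulr_ge0 (ltW mu_gt0) r_ge0.
  by rewrite /F; lra.
have L_gt0 := lt_le_trans mu_gt0 mu_le.
have := am_run_rate oF_inexact ophi_inexact opsi_inexact L_gt0 Lphi_gt0 H_gt0
  H_ge xstar run N_gt0.
move/le_trans; apply.
pose r := Num.sqrt (128 * H / mu); set n : R := (restart_len H mu)%:R.
have r2 : r ^+ 2 = 128 * H / mu.
  by rewrite sqr_sqrtr // divr_ge0 ?mulr_ge0 // ltW.
have r_ge1 : 1 <= r.
  rewrite -[leLHS]sqrtr1 ler_wsqrtr // ler_pdivlMr // mul1r ltW //.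
have n_ge : r <= n by exact: restart_len_ge.
have n_le : n <= 2 * r.
  by have := restart_len_le H mu; rewrite -/r -/n; lra.
apply: lerD.
  rewrite ler_wpM2r // ler_pdivrMr ?exprn_gt0 ?ltr0n //.
  have -> : 4 * H = mu / 32 * r ^+ 2 by rewrite r2; field; rewrite gt_eqF.
  have r_ge0' : 0 <= r by exact: sqrtr_ge0.
  by rewrite ler_wpM2l ?(divr_ge0 (ltW mu_gt0)) // lerXn2r ?nnegrE.
apply: (@le_trans _ _ (10496 * acc)); last first.
  by have := acc_le; have := acc_gt0; lra.
have -> : 10496 * acc = 2 * r ^+ 2 * (41 * (acc * (mu / H))).
  by rewrite r2; field; rewrite !gt_eqF.
apply: (@le_trans _ _ (n * (41 * (acc * (mu / H))))).
  by rewrite ler_wpM2l ?ler0n // am_step_error_le.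
apply: ler_wpM2r; first by rewrite !mulr_ge0 ?invr_ge0 // ltW.
by apply: le_trans n_le _; rewrite expr2 mulrA ler_peMr //; lra.
Qed.

Hypothesis xstar_min : is_minimizer F xstar.

(** The gap [mu / 32] and the growth [mu / 4] give a factor [1 / 8] per restart, weakened to
    [1 / 2]. The level [10 * eps] is stable, since [10 / 8 + 4] leaves room for the oracle
    errors. *)
Lemma ram_run_dist z0 K T z k : ram_run psi ophi opsi H mu tol z0 K T z ->
  (k <= K)%N -> mu * dotv (z k - xstar) (z k - xstar)
    <= mu * dotv (z0 - xstar) (z0 - xstar) / 2 ^+ k + 10 * eps.
Proof.
move=> [z0E runS]; elim: k => [_|k IH kK].
  by rewrite z0E expr0 divr1 lerDl mulr_ge0 // ltW.
have [run zE] := runS k kK; have := am_restart_gap run; rewrite -zE.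
have := inexact_oracle_growth oF_inexact (z k.+1) xstar_min.
have := IH (ltnW kK); have := accuracy_le; have := d1_le; have := d2_le.
have := dotv_ge0 (z k - xstar) => /(mulr_ge0 (ltW mu_gt0)).
rewrite exprS invfM; have := acc_le; have := acc_gt0; rewrite /F; lra.
Qed.

(** The distance is tracked through all restarts but the last, which converts it into a gap. *)
Lemma ram_run_gap z0 K T z : (0 < K)%N ->
  ram_run psi ophi opsi H mu tol z0 K T z ->
  F (z K) - F xstar
    <= mu * dotv (z0 - xstar) (z0 - xstar) / (16 * 2 ^+ K) + 2 * eps.
Proof.
case: K => // K _ run; have [run' zE] := run.2 K (ltnSn K).
have := am_restart_gap run'; rewrite -zE.
have := ram_run_dist run (leqnSn K).
have -> : mu * dotv (z0 - xstar) (z0 - xstar) / (16 * 2 ^+ K.+1)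
   = mu * dotv (z0 - xstar) (z0 - xstar) / 2 ^+ K / 32.
  by rewrite exprS; field; rewrite expf_neq0.
by have := acc_le; have := acc_gt0; rewrite /F; lra.
Qed.

End Restart.

(** * Counting the oracle calls *)

Lemma size_flatten_map_const (S S' : Type) (g : S -> seq S') (s : seq S) n :
  (forall x, size (g x) = n) ->
  size (flatten [seq g x | x <- s]) = (size s * n)%N.
Proof. by move=> gE; elim: s => //= x s IH; rewrite size_cat gE IH. Qed.

Section Counting.
Variables (R : realType).
Implicit Types (H mu eps x : R).

Lemma ram_callsE H mu K : ram_calls H mu K = (K * restart_len H mu)%N.
Proof. by rewrite /ram_calls sum_nat_const card_ord. Qed.

Lemma size_ram_psi_queries d H mu K (T : nat -> am_trace R d) :
  size (ram_psi_queries H mu K T) = ram_calls H mu K.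
Proof.
rewrite (@size_flatten_map_const _ _ _ _ (restart_len H mu)) => [|k].
  by rewrite size_iota ram_callsE.
by rewrite size_map size_iota.
Qed.

Lemma size_ram_phi_queries d H mu K (T : nat -> am_trace R d) :
  size (ram_phi_queries H mu K T) = (2 * ram_calls H mu K)%N.
Proof.
rewrite (@size_flatten_map_const _ _ _ _ (restart_len H mu * 2)) => [|k].
  by rewrite size_iota ram_callsE mulnA mulnC.
by rewrite (@size_flatten_map_const _ _ _ _ 2) ?size_iota.
Qed.

Lemma ln2_gt0 : 0 < ln 2 :> R.
Proof. by rewrite ln_gt0 // ltr1n. Qed.

Lemma le_exp2_of_log2 x n : 0 < x -> log2 x <= n%:R -> x <= 2 ^+ n.
Proof.
move=> x_gt0; rewrite /log2 ler_pdivrMr ?ln2_gt0 // mulr_natl -lnXn //.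
by rewrite ler_ln ?posrE ?exprn_gt0.
Qed.

Lemma log2_div4 x : 0 < x -> log2 (x / 4) = log2 x - 2.
Proof.
move=> x_gt0; have ln2 := ln2_gt0.
have -> : 4 = 2 ^+ 2 :> R by ring.
rewrite /log2 ln_div ?posrE ?exprn_gt0 // lnXn // mulr2n.
by field; rewrite gt_eqF.
Qed.

(** Rounding [K] up costs at most [1], while the division by [4] inside the logarithm saves [4], so
    [K <= 2 * log2 Y]. *)
Lemma ram_calls_le H mu (R0 : R) eps K : 0 < H -> 0 < mu ->
  0 < mu * R0 ^+ 2 / eps ->
  K%:Z = Num.ceil (2 * log2 (mu * R0 ^+ 2 / (4 * eps))) ->
  (ram_calls H mu K)%:R <= calls_bound H mu R0 eps.
Proof.
move=> H_gt0 mu_gt0 Y_gt0 KE; set Y := mu * R0 ^+ 2 / eps in Y_gt0.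
have KE' : mu * R0 ^+ 2 / (4 * eps) = Y / 4 by rewrite /Y invfM mulrCA mulrC.
have K_le : K%:R <= 2 * log2 Y.
  have := ceilB1_lt (2 * log2 (mu * R0 ^+ 2 / (4 * eps))).
  by rewrite -KE KE' log2_div4 // intrD -pmulrn; lra.
rewrite ram_callsE natrM /calls_bound -/Y.
have N_le := restart_len_le H mu.
have sqrtE : Num.sqrt (128 * H / mu) = 8 * Num.sqrt 2 * Num.sqrt (H / mu).
  have -> : 128 * H / mu = 8 ^+ 2 * (2 * (H / mu)) by field; rewrite gt_eqF.
  by rewrite sqrtrM ?exprn_ge0 // sqrtr_sqr ger0_norm // sqrtrM // mulrA.
apply: le_trans (ler_pM _ _ K_le N_le) _ => //.
by rewrite sqrtE; lra.
Qed.

Lemma calls_bound_softO :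
  softO [set t : R * R * R | [/\ 0 < t.1.1, 0 < t.1.2 & 0 < t.2]]
    (fun t e => calls_bound t.1.1 t.1.2 t.2 e)
    (fun t => Num.max (Num.sqrt (t.1.1 / t.1.2)) 1).
Proof.
(* Once [|ln c| <= ln e^-1], the logarithm is at most [2 * ln e^-1 / ln 2]; only this threshold on
   [e] depends on the parameters. *)
exists ((16 * Num.sqrt 2 + 2) * 2 / ln 2), 1%N.
move=> [[H mu] R0] /= [H_gt0 mu_gt0 R0_gt0].
pose c := mu * R0 ^+ 2; have c_gt0 : 0 < c by rewrite mulr_gt0 ?exprn_gt0.
near=> e.
have e_gt0 : 0 < e by near: e; exact: nbhs_right_gt.
have e_lt : e < expR (- `|ln c|).
  by near: e; apply: nbhs_right_lt; exact: expR_gt0.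
have ln_ge : `|ln c| <= ln e^-1.
  rewrite lnV ?posrE // lerNr -[leRHS]expRK ler_ln ?posrE ?expR_gt0 //.
  exact: ltW.
have s_ge0 := sqrtr_ge0 (H / mu); set s := Num.sqrt (H / mu) in s_ge0 *.
have ln2 := ln2_gt0.
set m := Num.max s 1.
have m_ge1 : 1 <= m by rewrite le_max lexx orbT.
have s_le : s <= m by rewrite le_max lexx.
have sq_ge0 := sqrtr_ge0 (2 : R).
rewrite /calls_bound -/c -/s expr1 normrM (ger0_norm (x := m)); last by lra.
rewrite ger0_norm; last by rewrite addr_ge0 ?mulr_ge0.
have log_le : `|log2 (c / e)| <= 2 * ln e^-1 / ln 2.
  rewrite /log2 normrM normfV (ger0_norm (ltW ln2)) ler_pM2r ?invr_gt0 //.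
  rewrite lnM ?posrE ?invr_gt0 // (le_trans (ler_normD _ _)) //.
  by rewrite (ger0_norm (x := ln e^-1)); [lra | exact: le_trans ln_ge].
apply: (@le_trans _ _ ((16 * Num.sqrt 2 + 2) * m * (2 * ln e^-1 / ln 2))).
  apply: ler_pM => //; first by rewrite addr_ge0 ?mulr_ge0.
  by have := ler_wpM2l (mulr_ge0 (ler0n R 16) sq_ge0) s_le; lra.
rewrite (_ : _ * 2 / _ * _ * m
  = (16 * Num.sqrt 2 + 2) * m * (2 * ln e^-1 / ln 2)) //.
by field; rewrite gt_eqF.
Unshelve. all: by end_near.
Qed.

End Counting.

(** * Choice of the constants and assembly *)

Theorem theorem3 (R : realType) (d : nat)
    (phi psi : 'rV[R]_d -> R) (xstar : 'rV[R]_d)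
    (eps d1 d2 L mu Lphi Lpsi H R0 epsf : R)
    (oF ophi opsi : oracle R d)
    (z0 : 'rV[R]_d) (K : nat)
    (T : nat -> am_trace R d) (z : nat -> 'rV[R]_d)
    (F := fun x => phi x + psi x)
    (phi_convex : convex_function [set: 'rV[R]_d] phi)
    (psi_convex : convex_function [set: 'rV[R]_d] psi)
    (xstar_min : is_minimizer F xstar)
    (eps_gt0 : 0 < eps) (d1_gt0 : 0 < d1) (d2_gt0 : 0 < d2)
    (mu_gt0 : 0 < mu) (Lphi_gt0 : 0 < Lphi) (Lpsi_gt0 : 0 < Lpsi)
    (oF_inexact : inexact_oracle d1 d2 L mu F oF)
    (ophi_inexact : inexact_oracle d1 d2 Lphi 0 phi ophi)
    (opsi_inexact : inexact_oracle d1 d2 Lpsi 0 psi opsi)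
    (H_gt0 : 0 < H) (H_ge : 2 * Lphi <= H)
    (R0_gt0 : 0 < R0) (z0_close : enorm (z0 - xstar) <= R0)
    (epsf_le : epsf <= eps * mu ^+ 2 / (864 ^+ 2 * (L + H) ^+ 2))
    (d_le : Num.max d1 d2 <=
       Num.min (eps * mu / (864 ^+ 2 * Lphi))
      (Num.min (eps * mu / (864 ^+ 2 * Lpsi))
      (Num.min (eps * mu ^+ 2 / (864 ^+ 2 * (L + H) ^+ 2))
               (eps `^ (3 / 2) / (5 * Num.sqrt (8 * H * R0 ^+ 2))))))
    (K_gt0 : (0 < K)%N)
    (K_def : K%:Z = Num.ceil (2 * log2 (mu * R0 ^+ 2 / (4 * eps))))
    (run : ram_run psi ophi opsi H mu epsf z0 K T z) :
  [/\ F (z K) - F xstar <= eps,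
      (ram_calls H mu K)%:R <= calls_bound H mu R0 eps,
      size (ram_psi_queries H mu K T) = ram_calls H mu K,
      size (ram_phi_queries H mu K T) = (2 * ram_calls H mu K)%N
    & softO [set t : R * R * R | [/\ 0 < t.1.1, 0 < t.1.2 & 0 < t.2]]
        (fun t e => calls_bound t.1.1 t.1.2 t.2 e)
        (fun t => Num.max (Num.sqrt (t.1.1 / t.1.2)) 1)].
Proof.
pose acc := eps / 864 ^+ 2.
have accE : eps * mu ^+ 2 / (864 ^+ 2 * (L + H) ^+ 2)
    = acc * mu ^+ 2 / (L + H) ^+ 2 by rewrite invfM mulrACA mulrA.
have acc_gt0 : 0 < acc by rewrite divr_gt0 ?exprn_gt0 ?ltr0n.
(* [864 ^+ 2 = 746496] exceeds [70 * 10500 = 735000]; the restart lemmas are applied with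
   [eps / 70]. *)
have acc_le : 10500 * acc <= eps / 70 by rewrite /acc; lra.
clearbody acc; rewrite accE in epsf_le d_le.
have /andP[d1_le d2_le] : (d1 <= acc * mu ^+ 2 / (L + H) ^+ 2)
    && (d2 <= acc * mu ^+ 2 / (L + H) ^+ 2).
  by move: d_le; rewrite !le_min => /and4P[_ _ + _]; rewrite ge_max.
have Y_gt0 : 0 < mu * R0 ^+ 2 / eps by rewrite divr_gt0 ?mulr_gt0 ?exprn_gt0.
split.
(* In dimension [0] the oracle bounds do not force [mu <= L], but all points coincide. *)
- have [d0|d_gt0] := posnP d.
    have -> : z K = xstar by apply/rowP => i; have := ltn_ord i; rewrite {2}d0.
    by rewrite subrr ltW.
  have mu_le := inexact_oracle_strong_le oF_inexact d_gt0.
  apply: le_trans (ram_run_gap oF_inexact ophi_inexact opsi_inexact acc_gt0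
    acc_le mu_gt0 mu_le Lphi_gt0 H_gt0 H_ge epsf_le d1_le d2_le xstar_min K_gt0
    run) _.
  pose X := mu * R0 ^+ 2 / (4 * eps).
  have X_gt0 : 0 < X by rewrite divr_gt0 ?mulr_gt0 ?exprn_gt0.
  (* [0 < K] makes the logarithm positive, so [log2 X <= 2 * log2 X <= K]. *)
  have log_gt0 : 0 < 2 * log2 X by rewrite -ceil_gt0 -K_def ltz_nat.
  have log_le : 2 * log2 X <= K%:R by rewrite [K%:R]pmulrn K_def ceil_ge.
  have X_le : X <= 2 ^+ K by apply: le_exp2_of_log2 => //; lra.
  have r_le : dotv (z0 - xstar) (z0 - xstar) <= R0 ^+ 2.
    by rewrite -sqr_enorm lerXn2r ?nnegrE ?sqrtr_ge0 // ltW.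
  have : mu * dotv (z0 - xstar) (z0 - xstar) / (16 * 2 ^+ K) <= eps / 4.
    rewrite ler_pdivrMr ?mulr_gt0 ?exprn_gt0 //.
    apply: (@le_trans _ _ (4 * eps * X)).
      have -> : 4 * eps * X = mu * R0 ^+ 2 by rewrite /X; field; rewrite gt_eqF.
      by rewrite ler_pM2l.
    by have := ler_wpM2l (ltW eps_gt0) X_le; lra.
  by lra.
- exact: ram_calls_le.
- exact: size_ram_psi_queries.
- exact: size_ram_phi_queries.
- exact: calls_bound_softO.
Qed.
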